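(* For every fixed integer $t\ge 2$, $\mathrm{Ex}(P_t,n)=\Theta\big(n(\log n/\log\log n)^t\big)$ as $n\to\infty$ (the implied constants may depend on $t$).
   Context: A pattern is a 0--1 matrix. A 0--1 matrix $A$ contains a pattern $P$ if $A$ can be transformed into $P$ by removing rows and columns from $A$ (keeping the order of the remaining ones) and changing some 1s to 0s; otherwise $A$ is $P$-free. $\mathrm{Ex}(P,n)$ is the maximum number of 1s in an $n\times n$ 0--1 matrix that is $P$-free. $\log$ is the binary logarithm. The alternating pattern $P_t$ is the $2\times(t+2)$ 0--1 matrix with rows indexed $0,1$ (top to bottom) and columns indexed $0,1,\dots,t+1$ (left to right), whose column $0$ has 1s in both rows, and whose column $j$, for $1\le j\le t+1$, has exactly one 1, located in row $0$ if $j$ is odd and in row $1$ if $j$ is even. For example $P_1=\begin{pmatrix}1&1&0\\1&0&1\end{pmatrix}$. *)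

(* Defs.v *)
From mathcomp Require Import all_boot all_order all_algebra.
From mathcomp Require Import all_classical all_reals all_analysis.
Import numFieldNormedType.Exports.

Set Implicit Arguments.
Unset Strict Implicit.
Unset Printing Implicit Defensive.

Local Open Scope ring_scope.

(* The strictly increasing f and g select the rows and columns of A that are
   kept; the implication accounts for changing some 1s (true) to 0s. *)
Definition contains m n k l (A : 'M[bool]_(m, n)) (P : 'M[bool]_(k, l)) : Prop :=
  exists (f : 'I_k -> 'I_m) (g : 'I_l -> 'I_n),
    [/\ {homo f : i j / (i < j)%N}, {homo g : i j / (i < j)%N}
      & forall i j, P i j -> mxsub f g A i j].

Definition pattern_free m n k l (P : 'M[bool]_(k, l)) (A : 'M[bool]_(m, n)) : Prop :=
  ~ contains A P.

Definition weight m n (A : 'M[bool]_(m, n)) : nat :=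
  #|[set ij : 'I_m * 'I_n | A ij.1 ij.2]|.

Definition Ex k l (P : 'M[bool]_(k, l)) (n : nat) : nat :=
  (\max_(A : 'M[bool]_n | `[< pattern_free P A >]) weight A)%N.

Definition alternating_pattern (t : nat) : 'M[bool]_(2, t.+2) :=
  \matrix_(i < 2, j < t.+2)
    ((j == ord0) || (if odd j then i == ord0 else i == ord_max)).

Definition log2 (R : realType) (x : R) : R := ln x / ln 2.

Lemma alternating_pattern1E (i : 'I_2) (j : 'I_3) :
  alternating_pattern 1 i j =
  nth false (nth [::] [:: [:: true; true; false]; [:: true; false; true]] i) j.
Proof.
rewrite mxE; case: i => [[|[|//]] ?]; case: j => [[|[|[|//]]] ?] //.
Qed.

(* Main.v *)
(** Write [l = log n] and [s = log log n].
    Upper bound: fix [m] a small power of [l] and call a 1 in column [c] of a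
    row spread if the row has 1s at distances [d_0 < ... < d_t] to the right of
    [c] with [d_(j+1) > (1 + 1/m) d_j].  Grouping columns by the order of
    magnitude, in base [m + 1], of their distance to the last 1 of the row shows
    that a row has only [O((l / s)^t)] 1s that are not spread.  If two rows have
    a spread 1 in the same column and their distances [d_1, ..., d_(t-1)] agree
    to relative precision [1/m], then the two chains interleave and form the
    alternating pattern; so a column has only [O((m l)^(t-1)) = o((l / s)^t)]
    spread 1s.
    Lower bound: rows are words of length [t L] over [M >= (2 t L)^t] letters,
    cut into [t] blocks of length [L], where [L] is of order [l / s].  A 1 of a
    row marks one letter in each block; the column word keeps the unmarked
    letters and replaces each marked letter by its difference with the first
    marked one.  Rows sharing a column then differ exactly at the marks, all in
    the same direction, and reading unmarked letters in alternating orientation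
    in consecutive blocks makes the later columns of the two rows form exactly
    [t + 1] runs, starting with the wrong row for the pattern. *)
Require Import Defs.
From mathcomp Require Import all_boot all_order all_algebra.
From mathcomp Require Import all_classical all_reals all_analysis.
From mathcomp Require Import zify.
Import numFieldNormedType.Exports.
Set Implicit Arguments.
Unset Strict Implicit.
Unset Printing Implicit Defensive.

Definition spread (m n : nat) (X : {set 'I_n}) (c : 'I_n) (s : nat) : Prop :=
  exists x : nat -> 'I_n,
    [/\ forall j, j < s -> x j \in X, forall j, j < s -> c < x j
      & forall j, j.+1 < s -> m.+1 * (x j - c) < m * (x j.+1 - c)].

(** Induction on [s], grouping [Y] by the order of magnitude, in base [m.+1], of the distance to the
    last element [L] of [X]. A spread chain inside one of the [K] groups of [X] extends by [L] to a
    longer chain in [X], so the induction hypothesis applies to each group; [L] itself is paid for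
    by passing from [K] to [K.+1]. *)
Lemma card_not_spread (m n K s : nat) (X Y : {set 'I_n}) :
    0 < m -> n <= m.+1 ^ K -> Y \subset X ->
    (forall c, c \in Y -> ~ spread m X c s.+1) -> #|Y| <= K.+1 ^ s.
Proof.
move=> m_gt0 nK; elim: s X Y => [|s IHs] X Y sYX notY.
  have maxY c : c \in Y -> forall x, x \in X -> x <= c.
    move=> cY x xX; rewrite leqNgt; apply/negP => ltcx.
    by apply: (notY c cY); exists (fun=> x).
  apply/card_le1_eqP => x y xY yY; apply/val_inj/eqP.
  by rewrite eqn_leq !(maxY x, maxY y) ?(fintype.subsetP sYX).
have [X0|[c0 c0X]] := set_0Vmem X.
  by move: sYX; rewrite X0 finset.subset0 => /eqP ->; rewrite cards0.
pose L := [arg max_(x > c0 in X) (x : nat)].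
have [LX maxL] : L \in X /\ forall x, x \in X -> x <= L.
  by rewrite /L; case: arg_maxnP.
pose lev (x : 'I_n) := trunc_log m.+1 (L - x).
pose Xk k := [set x in X | (x != L) && (lev x == k)].
pose Yk (k : 'I_K) := Y :&: Xk k.
have b_gt1 : 1 < m.+1 by [].
have sub : Y \subset L |: \bigcup_k Yk k.
  apply/fintype.subsetP => c cY; have [->|cL] := eqVneq c L; first by rewrite finset.setU11.
  have cX := fintype.subsetP sYX c cY.
  have ltcL : c < L by rewrite ltn_neqAle maxL // andbT.
  have ltK : lev c < K.
    rewrite -(ltn_exp2l _ _ b_gt1); apply: leq_ltn_trans (trunc_logP b_gt1 _) _.
      by rewrite subn_gt0.
    by apply: leq_trans nK; apply: leq_ltn_trans (leq_subr _ _) (ltn_ord L).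
  apply/finset.setU1P; right; apply/finset.bigcupP; exists (Ordinal ltK) => //.
  by rewrite !inE cY cX cL eqxx.
have cardYk k : #|Yk k| <= K.+1 ^ s.
  apply: (IHs (Xk k)); first exact: finset.subsetIr.
  move=> c; rewrite !inE => /and4P[cY cX cL /eqP levc] [x [xX cx xgap]].
  apply: (notY c cY); exists (fun j => if j < s.+1 then x j else L); split.
  - by move=> j _; case: ifP => // js; have := xX _ js; rewrite inE => /andP[].
  - move=> j _; case: ifP => [js|_]; first exact: cx.
    by rewrite ltn_neqAle maxL // andbT.
  move=> j; rewrite !ltnS => js; rewrite js; case: ifP => [js'|/negbT].
    exact: xgap.
  rewrite -leqNgt => sj; have Ej : j = s by apply/eqP; rewrite eqn_leq js.
  have := xX s (leqnn _); rewrite -Ej inE => /and3P[xjX xjL /eqP levx].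
  have ltxL : x j < L by rewrite ltn_neqAle xjL maxL.
  have ltcL : c < L by rewrite ltn_neqAle cL maxL.
  have ltcx : c < x j by apply: cx; rewrite Ej.
  (* Since [c] and [x j] lie on the same level, [L - c < m.+1 * (L - x j)], which rearranges to the
     gap required between [x j] and [L]. *)
  have := @trunc_logP m.+1 (L - x j) b_gt1; rewrite subn_gt0 => /(_ ltxL).
  have := trunc_log_ltn (L - c) b_gt1.
  rewrite -/(lev c) -/(lev (x j)) levc levx expnS => h1 h2.
  have : L - c < m.+1 * (L - x j).
    by apply: leq_trans h1 _; rewrite leq_mul2l h2 orbT.
  by nia.
apply: leq_trans (subset_leq_card sub) _.
apply: leq_trans (leq_card_setU _ _) _.
rewrite cards1.
have : #|\bigcup_k Yk k| <= K * K.+1 ^ s.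
  have -> : K * K.+1 ^ s = \sum_(k < K) K.+1 ^ s by rewrite sum_nat_const card_ord.
  elim/big_ind2: _ => [|A p B q Ap Bq|k _]; [by rewrite cards0| |exact: cardYk].
  by apply: leq_trans (leq_card_setU _ _) _; rewrite leq_add.
rewrite expnS mulSn => h; rewrite leq_add //.
by rewrite expn_gt0.
Qed.

(** * Distances up to a relative error *)

Definition scale m d := trunc_log 2 (d %/ m.+1).+1.
(** A floating-point form of [d], with exponent and mantissa. The unit is at most [(d %/ m.+1).+1],
    fine enough to respect the gaps of a chain, yet of that order, so that few mantissas occur. *)
Definition approx m d := (scale m d, d %/ 2 ^ scale m d).

Lemma approx_close m d d' : approx m d = approx m d' ->
  d < d' + (d %/ m.+1).+1 /\ d' < d + (d %/ m.+1).+1.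
Proof.
move=> [Ek Eu].
have : 2 ^ scale m d <= (d %/ m.+1).+1 by apply: trunc_logP.
have := divn_eq d (2 ^ scale m d); have := divn_eq d' (2 ^ scale m d').
have := @ltn_pmod d (2 ^ scale m d); have := @ltn_pmod d' (2 ^ scale m d').
rewrite !expn_gt0 /= => /(_ isT) h1 /(_ isT) h2.
rewrite -Eu -Ek in h1 *.
lia.
Qed.

(** The gap forces [d - a] to be at least [(d %/ m.+1).+1], whereas [d - d'] stays below that
    value. *)
Lemma approx_lt_l m a d d' :
  approx m d = approx m d' -> m.+1 * a < m * d -> a < d'.
Proof.
move=> /approx_close [h1 h2] h.
by have := divn_eq d m.+1; have := @ltn_pmod d m.+1 isT; nia.
Qed.

Lemma approx_lt_r m b d d' :
  approx m d = approx m d' -> m.+1 * d < m * b -> d' < b.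
Proof.
move=> /approx_close [h1 h2] h.
by have := divn_eq d m.+1; have := @ltn_pmod d m.+1 isT; nia.
Qed.

Lemma approx_bound m n d : d <= n ->
  (approx m d).1 <= trunc_log 2 n.+1 /\ (approx m d).2 < 2 * m.+1.
Proof.
move=> dn; split => /=.
  by apply: leq_trunc_log; rewrite ltnS; apply: leq_trans (leq_div _ _) dn.
have h : (d %/ m.+1).+1 < 2 ^ (scale m d).+1 by apply: trunc_log_ltn.
rewrite expnS in h.
rewrite ltn_divLR ?expn_gt0 //.
have := divn_eq d m.+1; have := @ltn_pmod d m.+1 isT; nia.
Qed.

(** * The upper bound in terms of [m] and [K] *)

Lemma contains_alternating t n (A : 'M[bool]_n) (i i' : 'I_n) (x : nat -> 'I_n) :
    i < i' -> (forall j, j <= t -> x j < x j.+1) -> A i (x 0) -> A i' (x 0) ->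
    (forall j, j <= t -> A (if odd j then i' else i) (x j.+1)) ->
  contains A (alternating_pattern t).
Proof.
move=> ltii' xS Ai Ai' Ax.
exists (fun k => if k == ord0 then i else i'), (fun j => x j); split.
- by case=> [[|[|//]] ?] [[|[|//]] ?].
- have mono k j : j < k -> k <= t.+1 -> x j < x k.
    elim: k => // k IHk; rewrite ltnS leq_eqVlt => /predU1P[->|jk] kt.
      exact: xS.
    by apply: ltn_trans (xS k kt); apply: IHk => //; apply: ltnW.
  by move=> j k /mono; apply; rewrite -ltnS.
move=> k [[|j] jt]; rewrite !mxE /=; first by case: ifP.
rewrite -val_eqE /=; have := Ax j jt; case: ifP => jodd /=.
  by case: k => [[|[|//]] ?].
by case: k => [[|[|//]] ?].
Qed.

(** The 1s that are not spread are counted row by row. A spread 1 is coded by its column and by the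
    approximate distances [d_1, ..., d_(t-1)] of a chosen chain; two rows with the same code would
    contain the pattern, so the code is injective. *)
Lemma pattern_free_weight t m n K (A : 'M[bool]_n) :
    1 < t -> 0 < m -> n <= m.+1 ^ K -> pattern_free (alternating_pattern t) A ->
  weight A <= n * (K.+1 ^ t + ((trunc_log 2 n).+1 * (2 * m).+2) ^ t.-1).
Proof.
move=> t_gt1 m_gt0 nK freeA.
have [n0|n_gt0] := posnP n.
  rewrite [weight A]eq_card0 // => -[[k ltkn] c].
  by suff : k < 0 by []; rewrite -n0.
pose X i := [set c | A i c].
pose bad i := [set c in X i | `[< ~ spread m (X i) c t.+1 >]].
pose good := [set p : 'I_n * 'I_n | A p.1 p.2 && `[< spread m (X p.1) p.2 t.+1 >]].
have sub : [set ij : 'I_n * 'I_n | A ij.1 ij.2] \subset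
     [set p : 'I_n * 'I_n | p.2 \in bad p.1] :|: good.
  apply/fintype.subsetP => p; rewrite !inE => Ap; rewrite Ap /=.
  by case: (asboolP (spread _ _ _ _)) => h; [rewrite orbT | apply/orP; left; apply/asboolP].
apply: leq_trans (leq_trans (subset_leq_card sub) (leq_card_setU _ _)) _.
rewrite mulnDr leq_add //.
- rewrite -sum1_card.
    rewrite (eq_bigl (fun p : 'I_n * 'I_n => (p.2 \in bad p.1))); last first.
      by move=> p; rewrite inE.
    rewrite -(pair_big_dep xpredT (fun i c => c \in bad i) (fun _ _ => 1)) /=.
    have -> : n * K.+1 ^ t = \sum_(i < n) K.+1 ^ t by rewrite sum_nat_const card_ord.
    apply: leq_sum => i _.
    rewrite sum1_card; apply: (card_not_spread (m := m) (X := X i)) => //.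
      by apply/fintype.subsetP => c; rewrite inE => /andP[].
    by move=> c; rewrite inE => /andP[_ /asboolP].
  have /choice[x xP] : forall p : 'I_n * 'I_n, exists x : nat -> 'I_n,
      p \in good -> [/\ forall j, j < t.+1 -> x j \in X p.1,
        forall j, j < t.+1 -> p.2 < x j &
        forall j, j.+1 < t.+1 -> m.+1 * (x j - p.2) < m * (x j.+1 - p.2)].
    move=> p; case pg: (p \in good); last by exists (fun=> p.2).
    by move: pg; rewrite inE => /andP[_ /asboolP[x]]; exists x.
  pose d p j := x p j - p.2.
  pose sig (p : 'I_n * 'I_n) : {ffun 'I_t.-1 -> 'I_(trunc_log 2 n).+1 * 'I_(2 * m).+2} :=
    [ffun j : 'I_t.-1 => (inord (approx m (d p j.+1)).1, inord (approx m (d p j.+1)).2)].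
  have dn p j : d p j <= n.-1.
    by rewrite /d; apply: leq_trans (leq_subr _ _) _; rewrite -ltnS prednK.
  have sigE p p' j : sig p = sig p' -> 0 < j < t ->
      approx m (d p j) = approx m (d p' j).
    case: j => // j E /= jt.
    have jt' : j < t.-1 by rewrite -ltnS prednK // ltnW.
    have := congr1 (fun f : {ffun _ -> _} => f (Ordinal jt')) E.
    rewrite !ffunE /= => -[/(congr1 val) /= E1 /(congr1 val) /= E2].
    have [a1 a2] := approx_bound m (dn p j.+1).
    have [b1 b2] := approx_bound m (dn p' j.+1).
    rewrite prednK // in a1 b1; rewrite mulnS add2n in a2 b2.
    rewrite !inordK ?ltnS // in E1 E2.
    by rewrite /approx; congr (_, _).
  have key (i i' c : 'I_n) : (i, c) \in good -> (i', c) \in good ->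
      sig (i, c) = sig (i', c) -> i < i' -> False.
    move=> g g' E ltii'; apply: freeA.
    (* The shared column comes first, then the two chains are read alternately, starting with the
       upper row. *)
    pose y j := if j is j'.+1 then x (if odd j' then i' else i, c) j' else c.
    have gg b : ((if b then i' else i), c) \in good by case: b.
    have EE b b' : sig ((if b then i' else i), c) = sig ((if b' then i' else i), c).
      by case: b b' => [] [].
    apply: (contains_alternating (i := i) (i' := i') (x := y)) => //.
    - case=> [_|j jt] /=.
        by have [_ + _] := xP _ g; apply.
      have [xX cx xgap] := xP _ (gg (odd j)).
      have [xX' cx' xgap'] := xP _ (gg (~~ odd j)).
      suff : d ((if odd j then i' else i), c) j < d ((if ~~ odd j then i' else i), c) j.+1.
        move: (cx j (ltnW jt)) (cx' j.+1 jt); rewrite /d /=; lia.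
      (* [sig] records neither [d_0] nor [d_t], whence the exponent [t.-1]. The first comparison
         therefore transfers the larger distance [d_1] to the other row; each later one transfers
         the smaller distance. *)
      case: j jt {xX xX'} cx cx' xgap xgap' => [|j] jt cx cx' xgap xgap'.
        apply: approx_lt_l (xgap 0 jt).
        by apply: sigE => //; apply: EE.
      apply: approx_lt_r (xgap' j.+1 jt).
      by apply: sigE => //; apply: EE.
    - by have := g; rewrite inE => /andP[].
    - by have := g'; rewrite inE => /andP[].
    move=> j jt; have [xX _ _] := xP _ (gg (odd j)).
    by have := xX j jt; rewrite inE.
  pose code p := (p.2 : 'I_n, sig p).
  have inj : {in good &, injective code}.
    move=> [i c] [i' c'] g g' [Ec E]; rewrite -Ec in g' E *.
    congr (_, _); apply/val_inj; case: (ltngtP i i') => // lt.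
      by case: (key i i' c).
    by case: (key i' i c).
  rewrite -(card_in_imset inj); apply: leq_trans (max_card _) _.
  by rewrite card_prod card_ffun card_prod !card_ord.
Qed.

(** * Words read as numbers, most significant letter first *)

Fixpoint numeral (B : nat) (f : nat -> nat) (T : nat) : nat :=
  if T is T'.+1 then numeral B f T' * B + f T' else 0.

Lemma eq_numeral B f g T :
  (forall p, p < T -> f p = g p) -> numeral B f T = numeral B g T.
Proof.
elim: T => //= T IH fg; rewrite fg // IH // => p pT.
by apply: fg; rewrite ltnS ltnW.
Qed.

Lemma numeral_lt_exp B f T : (forall p, p < T -> f p < B) -> numeral B f T < B ^ T.
Proof.
elim: T => [|T IH] fB; first by rewrite expn0.
have h : numeral B f T < B ^ T by apply: IH => p pT; apply: fB; rewrite ltnS ltnW.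
by have := fB T (leqnn _); rewrite /= expnS; nia.
Qed.

Lemma numeral_ltn B f g q T :
    (forall p, p < T -> f p < B) -> q < T ->
    (forall p, p < q -> f p = g p) -> f q < g q ->
  numeral B f T < numeral B g T.
Proof.
elim: T => //= T IH fB; rewrite ltnS leq_eqVlt => /predU1P[->|qT] fg lt.
  by rewrite (eq_numeral _ fg) ltn_add2l.
have h : numeral B f T < numeral B g T.
  by apply: IH => // p pT; apply: fB; rewrite ltnS ltnW.
by have := fB T (leqnn _); nia.
Qed.

Lemma ltn_numeral_first B f g T :
    (forall p, p < T -> g p < B) -> numeral B f T < numeral B g T ->
  exists q, [/\ q < T, forall p, p < q -> f p = g p & f q < g q].
Proof.
move=> gB lt.
have /ex_minnP[q /andP[qT fgq] minq] : exists p, (p < T) && (f p != g p).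
  have [/existsP[p fgp]|/existsPn eqfg] := boolP [exists p : 'I_T, f p != g p].
    by exists p; rewrite ltn_ord.
  suff E : numeral B f T = numeral B g T by rewrite E ltnn in lt.
  by apply: eq_numeral => p pT; have := eqfg (Ordinal pT); rewrite negbK => /eqP.
have agree p : p < q -> f p = g p.
  move=> pq; apply/eqP; apply/negPn/negP => fgp.
  by have := minq p; rewrite (ltn_trans pq qT) fgp leqNgt pq => /(_ isT).
exists q; split=> //; rewrite ltn_neqAle fgq leqNgt; apply/negP => gfq.
have : numeral B g T < numeral B f T.
  by apply: (@numeral_ltn _ _ _ q) => // p /agree.
by rewrite ltnNge ltnW.
Qed.

Lemma numeral_inj B f g T :
    (forall p, p < T -> f p < B) -> (forall p, p < T -> g p < B) ->
    numeral B f T = numeral B g T -> forall p, p < T -> f p = g p.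
Proof.
elim: T => // T IH fB gB /= E.
have fB' p : p < T -> f p < B by move=> pT; apply: fB; rewrite ltnS ltnW.
have gB' p : p < T -> g p < B by move=> pT; apply: gB; rewrite ltnS ltnW.
have [fT gT] := (fB T (leqnn _), gB T (leqnn _)).
have E1 : f T = g T.
  by have := congr1 (modn^~ B) E; rewrite !modnMDl !modn_small.
have E2 : numeral B f T = numeral B g T by nia.
by move=> p; rewrite ltnS leq_eqVlt => /predU1P[->//|]; apply: IH.
Qed.

(** * Column words with marked letters *)

Section Columns.
Variables t L M : nat.
Implicit Types (f g h : nat -> nat).

Definition marked h p := p == p %/ L * L + h (p %/ L).
(* Alternating the orientation of the blocks makes the last run of a block and
   the first run of the preceding block belong to the same row. *)
Definition omega p a := if odd (t - p %/ L) then M.-1 - a else a.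
(* The summand [M] keeps the difference from being truncated. *)
Definition raw h f p := if marked h p then f p + M - f (h 0) else f p.
(** The shift by [2 * M] puts every unmarked letter above every marked one, which makes the marks
    readable from the word. Taking the raw word [e] as an argument lets columns be counted through
    their raw words. *)
Definition column h (e : nat -> nat) p :=
  if marked h p then e p else 2 * M + omega p (e p).

Definition marks h := forall j, j < t -> h j < L.
Definition digits f := forall p, p < t * L -> f p < M.

Let q h j := j * L + h j.

Lemma div_mark h j : marks h -> j < t -> q h j %/ L = j.
Proof.
move=> hL jt; have hjL := hL j jt; rewrite divnMDl ?divn_small ?addn0 //.
exact: leq_ltn_trans hjL.
Qed.

Lemma mark_lt h j : marks h -> j < t -> q h j < t * L.
Proof. by move=> hL jt; have := hL j jt; rewrite /q; nia. Qed.

Lemma marked_mark h j : marks h -> j < t -> marked h (q h j).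
Proof. by move=> hL jt; rewrite /marked div_mark. Qed.

Lemma markedP h p : marks h -> p < t * L -> marked h p ->
  exists2 j, j < t & p = q h j.
Proof.
move=> hL pT /eqP E; exists (p %/ L) => //.
rewrite ltn_divLR //; case: (L) pT => //; by rewrite muln0.
Qed.

Lemma raw_lt h f p : marks h -> digits f -> 0 < t -> p < t * L ->
  marked h p -> raw h f p < 2 * M.
Proof.
move=> hL fM t_gt0 pT pm; rewrite /raw pm.
have h0 : h 0 < t * L by have := hL 0 t_gt0; nia.
have := fM _ pT; have := fM _ h0; lia.
Qed.

Lemma omega_lt p a : a < M -> omega p a < M.
Proof. by rewrite /omega; case: ifP; lia. Qed.

Lemma column_lt h f p : marks h -> digits f -> 0 < t -> p < t * L ->
  column h (raw h f) p < 3 * M.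
Proof.
move=> hL fM t_gt0 pT; rewrite /column; case: ifP => pm.
  by have := raw_lt hL fM t_gt0 pT pm; lia.
by rewrite /raw pm; have := omega_lt p (fM p pT); lia.
Qed.

Lemma column_lt_marked h f p : marks h -> digits f -> 0 < t -> p < t * L ->
  (column h (raw h f) p < 2 * M) = marked h p.
Proof.
move=> hL fM t_gt0 pT; rewrite /column; case: ifP => pm.
  by rewrite raw_lt.
by apply/negbTE; rewrite -leqNgt leq_addr.
Qed.

Definition column_value h f := numeral (3 * M) (column h (raw h f)) (t * L).

(** The letters below [2 * M] reveal the marks; [omega] is injective on digits, so the unmarked
    letters of the row are recovered; the marked letters give the differences with the first marked
    one. *)
Lemma column_value_eq h h' f f' : 0 < t -> marks h -> marks h' -> digits f -> digits f' ->
    column_value h f = column_value h' f' ->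
  [/\ forall j, j < t -> h j = h' j,
    forall p, p < t * L -> ~~ marked h p -> f p = f' p &
    forall j, j < t -> f (q h j) + f' (q h 0) = f' (q h j) + f (q h 0)].
Proof.
move=> t_gt0 hL hL' fM fM' /numeral_inj E.
have {E}colE p : p < t * L -> column h (raw h f) p = column h' (raw h' f') p.
  by apply: E => r; apply: column_lt.
have markE p : p < t * L -> marked h p = marked h' p.
  by move=> pT; rewrite -(column_lt_marked hL fM) // colE // column_lt_marked.
have hE j : j < t -> h j = h' j.
  move=> jt; have qT := mark_lt hL jt.
  have := marked_mark hL jt; rewrite markE // => /eqP.
  by rewrite div_mark // => /addnI.
split=> // [p pT pm|j jt].
  have := colE p pT; rewrite /column /raw -markE // (negbTE pm) => /addnI.
  have := fM p pT; have := fM' p pT; rewrite /omega; case: ifP; lia.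
have qT := mark_lt hL jt; have q0T := mark_lt hL t_gt0.
have := colE _ qT; rewrite /column /raw -markE // marked_mark // -hE //.
have := fM _ q0T; have := fM' _ q0T; rewrite /q mul0n add0n; lia.
Qed.


(** The rows agree off the marks, so they first differ at a mark, and there [f] is smaller. By the
    last clause of [column_value_eq], [f' - f] is the same at all marks. *)
Lemma marked_rows_lt h h' f f' : 0 < t -> marks h -> marks h' -> digits f -> digits f' ->
    column_value h f = column_value h' f' ->
    numeral M f (t * L) < numeral M f' (t * L) ->
  forall j, j < t -> f (q h j) < f' (q h j).
Proof.
move=> t_gt0 hL hL' fM fM' E lt; have [hE unm mk] := column_value_eq t_gt0 hL hL' fM fM' E.
have [r [rT agree ltr]] := ltn_numeral_first fM' lt.
have rm : marked h r.
  by apply/negPn/negP => rm; move: ltr; rewrite unm ?ltnn.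
have [j jt rE] := markedP hL rT rm; subst r.
have q0 : h 0 <= q h j.
  by rewrite /q; case: (j) => [|i]; [lia | have := hL 0 t_gt0; nia].
have lt0 : f (q h 0) < f' (q h 0).
  move: q0; rewrite {2 3}/q mul0n add0n leq_eqVlt => /predU1P[->//|/agree E0].
  by have := mk j jt; rewrite {2 4}/q mul0n add0n E0; lia.
by move=> k kt; have := mk k kt; lia.
Qed.

(* [b] tells whether the row is the second one; among the columns leaving the
   shared column [C] at the [j]-th mark, those of one row precede those of the
   other, and the first row always gets an odd height. *)
Definition height j (b : bool) := t - j.+1 + (odd (t - j) (+) b).

(** * Later columns of two rows that share a column *)

Section TwoRows.
Variables (h f f' : nat -> nat).
Hypotheses (t_gt0 : 0 < t) (hL : marks h) (fM : digits f) (fM' : digits f').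
Hypothesis ltf : forall j, j < t -> f (q h j) < f' (q h j).
Hypothesis unmarkedE : forall p, p < t * L -> ~~ marked h p -> f p = f' p.
Hypothesis markedE : forall j, j < t -> f (q h j) + f' (q h 0) = f' (q h j) + f (q h 0).
Let row (b : bool) := if b then f' else f.
Let C : nat -> nat := column h (raw h f).

Lemma row_digits b : digits (row b). Proof. by case: b. Qed.

Lemma shared_columnE b p : p < t * L -> C p = column h (raw h (row b)) p.
Proof.
rewrite /row; case: b => //= pT; rewrite /C /column /raw.
case pm: (marked h p); last by rewrite unmarkedE ?pm.
have [j jt ->] := markedP hL pT pm.
have := markedE jt.
have := fM (mark_lt hL t_gt0); have := fM' (mark_lt hL t_gt0).
by rewrite /q mul0n add0n; lia.
Qed.

Definition leaves X j b := [/\ j < t, forall p, p < q h j -> X p = C p &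
  X (q h j) = 2 * M + omega (q h j) (row b (q h j))].

(** Consider the first position where the column exceeds [C]. Where [h] has no mark, [C] shows the
    shifted letter of the row itself, which the column can only repeat or replace by a smaller
    marked letter; so the position is a mark of [h]. *)
Lemma column_leaves g b : marks g ->
    numeral (3 * M) C (t * L) < column_value g (row b) ->
  exists j, leaves (column g (raw g (row b))) j b.
Proof.
move=> gL /ltn_numeral_first[p pT|r [rT agree lt]].
  by apply: column_lt => //; apply: row_digits.
have Cr := shared_columnE b rT.
have rm : marked h r.
  apply/negPn/negP => rm; move: lt; rewrite Cr /column /raw (negbTE rm).
  case gr: (marked g r); last by rewrite ltnn.
  have := row_digits b rT; have := omega_lt r (row_digits b rT).
  have := raw_lt gL (@row_digits b) t_gt0 rT; rewrite /raw.
  by rewrite gr => /(_ isT); lia.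
have [j jt rE] := markedP hL rT rm; exists j; subst r.
split=> //; first by move=> p /agree.
rewrite /column; case: ifP => gm; last by rewrite /raw gm.
(* If [g] marked this position too, both words would show a difference with the same first marked
   letter, hence equal letters. The first marks coincide because either this position is the first
   mark or the words already agree there. *)
have g0 : g 0 = h 0.
  case: j jt => [|j] jt in lt agree rT Cr rm gm *.
    by move: gm; rewrite /marked div_mark // /q !mul0n !add0n => /eqP ->.
  have q0T := mark_lt hL t_gt0.
  have q0lt : q h 0 < q h j.+1 by rewrite /q; have := hL t_gt0; nia.
  have := column_lt_marked gL (@row_digits b) t_gt0 q0T.
  rewrite -agree // (shared_columnE b) // column_lt_marked ?marked_mark //; last exact: row_digits.
  by rewrite /marked div_mark // /q !mul0n !add0n => /esym/eqP ->.
by move: lt; rewrite Cr /column gm rm /raw gm rm g0 ltnn.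
Qed.

(** A column [X'] of smaller height leaves [C] no earlier than [X]. If it leaves later, then at the
    [j]-th mark it still shows a marked letter, below the unmarked one of [X]. If both leave at the
    same mark, they read letters of different rows, which [omega] orders as [height] does. *)
Lemma height_mono X X' j b j' b' :
    (forall p, p < t * L -> X' p < 3 * M) ->
    leaves X j b -> leaves X' j' b' ->
    numeral (3 * M) X (t * L) < numeral (3 * M) X' (t * L) ->
  height j b <= height j' b'.
Proof.
move=> XM' [jt agree Xq] [jt' agree' Xq'].
apply: contraTT; rewrite -ltnNge -leqNgt => lth.
have qT := mark_lt hL jt; have qT' := mark_lt hL jt'.
apply/ltnW/(numeral_ltn (q := q h j)) => //.
  move=> p pq; rewrite agree //; apply: agree'; apply: leq_trans pq _.
  have : j <= j' by move: lth; rewrite /height; case: (_ (+) _); case: (_ (+) _) => /=; lia.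
  rewrite leq_eqVlt => /predU1P[->//|jj'].
  by rewrite /q; have := hL jt; nia.
have : j <= j' by move: lth; rewrite /height; case: (_ (+) _); case: (_ (+) _) => /=; lia.
rewrite leq_eqVlt => /predU1P[jj'|jj'].
  subst j'; rewrite Xq Xq' ltn_add2l /omega div_mark //.
  have := ltf jt; have := fM' qT.
  by move: lth; rewrite /height; case: ifP => _; case: b {Xq}; case: b' {Xq'} => /=; lia.
rewrite Xq agree'; last by rewrite /q; have := hL jt; nia.
apply: (@leq_trans (2 * M)); last by rewrite leq_addr.
by rewrite (shared_columnE false) // column_lt_marked ?marked_mark.
Qed.

Lemma odd_height j b : j < t -> odd (height j b) = ~~ b.
Proof.
move=> jt; rewrite /height oddD oddb -(subnSK jt) /=.
by case: (odd _); case: b.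
Qed.

(** Heights never decrease along the later columns and their parity identifies the row, so each
    change of row raises the height. Starting from an odd, hence positive, height, [t] changes lead
    above [t], the maximum. *)
Lemma no_alternation (g : nat -> nat -> nat) :
    (forall k, marks (g k)) ->
    numeral (3 * M) C (t * L) < column_value (g 0) f ->
    (forall k, k < t -> column_value (g k) (row (odd k)) <
                        column_value (g k.+1) (row (odd k.+1))) ->
  False.
Proof.
move=> gL lt0 ltS.
have lt k : k <= t -> numeral (3 * M) C (t * L) < column_value (g k) (row (odd k)).
  by elim: k => // k IH kt; apply: ltn_trans (ltS k kt); apply: IH; apply: ltnW.
have hgt k : k <= t -> forall j, leaves (column (g k) (raw (g k) (row (odd k)))) j (odd k) ->
    k < height j (odd k).
  elim: k => [|k IH] kt j' lv'.
    have [jt _ _] := lv'.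
    by have := odd_height (odd 0) jt; case: height.
  have [j lv] := column_leaves (gL k) (lt k (ltnW kt)).
  have := IH (ltnW kt) j lv.
  have : height j (odd k) <= height j' (odd k.+1).
    apply: height_mono lv lv' (ltS k kt) => p pT.
    by apply: column_lt => //; apply: row_digits.
  have [jt _ _] := lv; have [jt' _ _] := lv'.
  rewrite leq_eqVlt => /predU1P[E|h1 h2]; last exact: leq_ltn_trans h2 h1.
  have := congr1 odd E; rewrite !odd_height //=; by case: (odd k).
have [j lv] := column_leaves (gL t) (lt t (leqnn _)).
have := hgt t (leqnn _) j lv; have [jt _ _] := lv.
by rewrite /height; case: (_ (+) _) => /=; lia.
Qed.

End TwoRows.
End Columns.

(** * From families of positions to pattern-free matrices *)

Lemma weight_le_Ex k l (P : 'M[bool]_(k, l)) n (A : 'M[bool]_n) :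
  pattern_free P A -> weight A <= Ex P n.
Proof. by move=> freeA; apply: (bigmax_sup A) => //; apply/asboolP. Qed.

(* Only the relative order of the column positions [pos r l] matters, so that
   [n] columns suffice as soon as there are at most [n] positions. *)
Lemma Ex_alternating_ge t n (Row Lab : finType) (rv : Row -> nat)
    (pos : Row -> Lab -> nat) (S : seq nat) :
    injective rv -> (forall r, rv r < n) -> (forall r, injective (pos r)) ->
    (forall r l, pos r l \in S) -> size S <= n ->
    (forall r r' l l' (x : nat -> Lab),
      let row k := if odd k then r' else r in
      rv r < rv r' -> pos r l = pos r' l' -> pos r l < pos r (x 0) ->
      (forall k, k < t -> pos (row k) (x k) < pos (row k.+1) (x k.+1)) -> False) ->
  #|Row| * #|Lab| <= Ex (alternating_pattern t) n.
Proof.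
move=> rv_inj rv_lt pos_inj posS sizeS noalt.
pose S' := sort leq (undup S).
have posS' r l : pos r l \in S' by rewrite mem_sort mem_undup posS.
have S'_sorted : sorted ltn S'.
  by rewrite ltn_sorted_uniq_leq sort_uniq undup_uniq sort_sorted //; apply: leq_total.
have idx_lt r l : index (pos r l) S' < n.
  by apply: leq_trans sizeS; apply: leq_trans (size_undup S); rewrite -(size_sort leq) index_mem.
have idx_inj r l r' l' : index (pos r l) S' = index (pos r' l') S' -> pos r l = pos r' l'.
  by move=> E; rewrite -(nth_index 0 (posS' r l)) E nth_index.
have idx_mono r l r' l' : index (pos r l) S' < index (pos r' l') S' -> pos r l < pos r' l'.
  exact: (sorted_ltn_index ltn_trans S'_sorted).
pose A : 'M[bool]_n := (\matrix_(i, c)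
  [exists r, exists l, (rv r == i :> nat) && (index (pos r l) S' == c :> nat)])%R.
have AP (i c : 'I_n) : A i c -> exists r l, rv r = i /\ index (pos r l) S' = c.
  by rewrite mxE => /existsP[r /existsP[l /andP[/eqP ? /eqP ?]]]; exists r, l.
have freeA : pattern_free (alternating_pattern t) A.
  move=> [f [g [f_mono g_mono fgA]]].
  pose i := f ord0; pose i' := f ord_max.
  have ii' : i < i' by apply: f_mono.
  have [r [l [ri lc]]] : exists r l, rv r = i /\ index (pos r l) S' = g ord0.
    by apply: AP; have := fgA ord0 ord0; rewrite !mxE; apply.
  have [r' [l' [ri' lc']]] : exists r l, rv r = i' /\ index (pos r l) S' = g ord0.
    by apply: AP; have := fgA ord_max ord0; rewrite !mxE; apply.
  pose row k := if odd k then r' else r.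
  have /choice[x xP] : forall k, exists y, k <= t -> index (pos (row k) y) S' = g (inord k.+1).
    move=> k; case: (leqP k t) => kt; last by exists l.
    have : A (if odd k then i' else i) (g (inord k.+1)).
      have := fgA (if odd k then ord_max else ord0) (inord k.+1).
      rewrite !mxE inordK ?ltnS // -val_eqE /= inordK ?ltnS //=.
      by case: (odd k) => /(_ isT).
    move=> /AP[r1 [l1 [E1 E2]]].
    suff -> : row k = r1 by exists l1.
    by apply: rv_inj; rewrite E1 /row; case: (odd k).
  apply: (noalt r r' l l' x) => /=.
  - by rewrite ri ri'.
  - by apply: idx_inj; rewrite lc lc'.
  - apply: idx_mono; rewrite lc (xP 0) //; apply: g_mono; rewrite inordK //.
  move=> k kt; apply: idx_mono; rewrite (xP k (ltnW kt)) (xP k.+1 kt).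
  by apply: g_mono; rewrite !inordK ?ltnS // ltnW.
apply: leq_trans (weight_le_Ex freeA).
pose F (p : Row * Lab) := (Ordinal (rv_lt p.1), Ordinal (idx_lt p.1 p.2)).
have F_inj : injective F.
  move=> [r l] [r' l'] [/rv_inj Er /idx_inj E]; rewrite Er in E *.
  by rewrite (pos_inj _ _ _ E).
rewrite -card_prod -cardsT -(card_imset _ F_inj) subset_leq_card //.
apply/fintype.subsetP => p /imsetP[[r l] _ ->]; rewrite inE mxE.
by apply/existsP; exists r; apply/existsP; exists l; rewrite /= !eqxx.
Qed.

(** Finite functions provide the cardinalities, functions on [nat] the arithmetic of words; 0 is the
    default value out of range. *)
Definition natfun n m (F : {ffun 'I_n -> 'I_m}) (p : nat) : nat :=
  if insub p is Some i then F i : nat else 0.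

Lemma natfunE n m (F : {ffun 'I_n -> 'I_m}) (i : 'I_n) : natfun F i = F i.
Proof. by rewrite /natfun valK. Qed.

Lemma natfun_lt n m (F : {ffun 'I_n -> 'I_m}) p : p < n -> natfun F p < m.
Proof. by move=> pn; rewrite (natfunE F (Ordinal pn)). Qed.

Lemma natfun_inj n m (F G : {ffun 'I_n -> 'I_m}) :
  (forall p, p < n -> natfun F p = natfun G p) -> F = G.
Proof. by move=> FG; apply/ffunP => i; apply/val_inj; rewrite /= -!natfunE FG. Qed.

Lemma natfun_surj n m (f : nat -> nat) : (forall p, p < n -> f p < m) ->
  exists F : {ffun 'I_n -> 'I_m}, forall p, p < n -> natfun F p = f p.
Proof.
move=> fm; exists [ffun i : 'I_n => Ordinal (fm i (ltn_ord i))] => p pn.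
by rewrite (natfunE _ (Ordinal pn)) ffunE.
Qed.

Lemma card_ord_ltn n m : m <= n -> #|[pred i : 'I_n | i < m]| = m.
Proof. by move=> mn; rewrite -sum1_card -(big_ord_widen n (fun=> 1)) // sum1_card card_ord. Qed.

(** * Counting the rows and columns of the construction *)

Section Family.
Variables t L M : nat.
Hypothesis t_gt0 : 0 < t.

(* The first mark always carries the digit [M]: this loss of information is what
   keeps the number of columns below the number of rows. *)
Definition raw_family (h : {ffun 'I_t -> 'I_L}) (p : 'I_(t * L)) : pred 'I_(2 * M) :=
  if marked L (natfun h) p then
    (if p %/ L == 0 then [pred v : 'I_(2 * M) | v == M :> nat] else predT)
  else [pred v : 'I_(2 * M) | v < M].

(** The mark leaves one choice in block 0 and at most [2 * M] in every other block; each of the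
    [L.-1] other letters of a block has [M] choices. *)
Lemma card_raw_family (h : {ffun 'I_t -> 'I_L}) :
  #|family (raw_family h)| <= M ^ L.-1 * (2 * M * M ^ L.-1) ^ t.-1.
Proof.
pose c p := if marked L (natfun h) p then (if p %/ L == 0 then 1 else 2 * M) else M.
rewrite card_family foldrE big_map big_enum /=.
apply: (@leq_trans (\prod_(p < t * L) c p)).
  apply: leq_prod => p _; rewrite /raw_family /c; case: ifP => _; last first.
    by rewrite card_ord_ltn // mul2n -addnn leq_addr.
  case: ifP => _; last by rewrite cardT size_enum_ord.
  by apply/card_le1_eqP => v w /eqP vM /eqP wM; apply/val_inj; rewrite /= vM wM.
rewrite -(big_mkord xpredT c) big_nat_mul.
have inner j : j < t -> \prod_(j * L <= p < j.+1 * L) c p =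
    (if j == 0 then 1 else 2 * M) * M ^ L.-1.
  move=> jt; have hjL := natfun_lt h jt.
  rewrite -[j * L]add0n big_addn mulSn addnK big_mkord.
  have cE (a : 'I_L) : c (a + j * L) =
      if a == Ordinal hjL then (if j == 0 then 1 else 2 * M) else M.
    have L0 : 0 < L by apply: leq_ltn_trans (ltn_ord a).
    rewrite /c /marked addnC divnMDl // divn_small // addn0 eqn_add2l.
    by rewrite -val_eqE.
  rewrite (bigD1 (Ordinal hjL)) // cE eqxx; congr (_ * _).
  rewrite (eq_bigr (fun=> M)); last by move=> a /negbTE aj; rewrite cE aj.
  by rewrite prod_nat_const (cardC1 (Ordinal hjL)) card_ord.
rewrite big_nat (eq_bigr (fun j => (if j == 0 then 1 else 2 * M) * M ^ L.-1)); last first.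
  by move=> j /andP[_ /inner].
rewrite -big_nat big_mkord; case: (t) t_gt0 => // t' _.
rewrite big_ord_recl /= mul1n leq_mul2l; apply/orP; right.
by rewrite prod_nat_const card_ord.
Qed.

(** Every word is a row, with one 1 for each of the [L ^ t] choices of marks. Marks and raw words
    leave at most [L ^ t * 2 ^ t.-1 * M ^ (t * L - 1)] columns, and the lower bound on [M] turns
    this into at most [M ^ (t * L)]. *)
Lemma Ex_alternating_lower n : 0 < L -> L ^ t * 2 ^ t.-1 <= M -> M ^ (t * L) <= n ->
  M ^ (t * L) * L ^ t <= Ex (alternating_pattern t) n.
Proof.
move=> L_gt0 LM Mn.
have M_gt0 : 0 < M by apply: leq_trans LM; rewrite muln_gt0 !expn_gt0 L_gt0.
pose Row := {ffun 'I_(t * L) -> 'I_M}; pose Lab := {ffun 'I_t -> 'I_L}.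
have rowM (r : Row) : digits t L M (natfun r) by move=> p; apply: natfun_lt.
have labL (l : Lab) : marks t L (natfun l) by move=> j; apply: natfun_lt.
pose rv (r : Row) := numeral M (natfun r) (t * L).
pose pos (r : Row) (l : Lab) := column_value t L M (natfun l) (natfun r).
pose Z := [set z : Lab * {ffun 'I_(t * L) -> 'I_(2 * M)} | z.2 \in family (raw_family z.1)].
pose S := [seq numeral (3 * M) (column t L M (natfun z.1) (natfun z.2)) (t * L) | z <- enum Z].
have -> : M ^ (t * L) * L ^ t = #|Row| * #|Lab| by rewrite !card_ffun !card_ord.
apply: (@Ex_alternating_ge _ _ _ _ rv pos S).
- by move=> r r' /numeral_inj E; apply: natfun_inj; apply: E => p; apply: natfun_lt.
- by move=> r; apply: leq_trans Mn; apply: numeral_lt_exp => p; apply: natfun_lt.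
- move=> r l l' /(column_value_eq t_gt0 (labL l) (labL l') (rowM r) (rowM r)) [E _ _].
  exact: natfun_inj.
- move=> r l.
  have rawM p : p < t * L -> raw L M (natfun l) (natfun r) p < 2 * M.
    move=> pT; case pm: (marked L (natfun l) p).
      exact: (raw_lt (labL l) (rowM r) t_gt0 pT).
    by rewrite /raw pm; apply: ltn_trans (rowM r p pT) _; rewrite mul2n -addnn -ltn_subLR ?subnn.
  have [e eE] := natfun_surj rawM.
  apply/mapP; exists (l, e).
    rewrite mem_enum inE; apply/familyP => p /=.
    rewrite /raw_family; have := eE p (ltn_ord p); rewrite natfunE /raw.
    case: ifP => pm ep; last by rewrite inE ep rowM.
    (* In block 0 the marked letter is compared with itself, so its raw value is [M]. *)
    case: ifP => // /eqP p0; rewrite inE ep.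
    by move/eqP: pm; rewrite p0 mul0n add0n => <-; rewrite addnC addnK.
  by apply: eq_numeral => p pT; rewrite /column eE.
- rewrite size_map -cardE; apply: leq_trans Mn.
  rewrite -sum1_card (eq_bigl (fun z : Lab * {ffun 'I_(t * L) -> 'I_(2 * M)} =>
    z.2 \in family (raw_family z.1))); last by move=> z; rewrite inE.
  rewrite -(pair_big_dep xpredT (fun l e => e \in family (raw_family l)) (fun _ _ => 1)) /=.
  apply: (@leq_trans (\sum_(l : Lab) M ^ L.-1 * (2 * M * M ^ L.-1) ^ t.-1)).
    by apply: leq_sum => l _; rewrite sum1_card card_raw_family.
  rewrite sum_nat_const card_ffun !card_ord mulnC.
  have -> : M ^ (t * L) = (M ^ L.-1 * (M * M ^ L.-1) ^ t.-1) * M.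
    by rewrite mulnAC [_ ^ _ * M]mulnC -expnS prednK // -expnS prednK // -expnM mulnC.
  rewrite -[2 * M * _]mulnA expnMn.
  have := leq_mul (leqnn (M ^ L.-1 * (M * M ^ L.-1) ^ t.-1)) LM.
  by apply: leq_trans; rewrite leq_eqVlt; apply/orP; left; apply/eqP; nia.
move=> r r' l l' x row ltr E lt0 ltS.
have [hE unm mk] := column_value_eq t_gt0 (labL l) (labL l') (rowM r) (rowM r') E.
have ltm := marked_rows_lt t_gt0 (labL l) (labL l') (rowM r) (rowM r') E ltr.
apply: (no_alternation t_gt0 (labL l) (rowM r) (rowM r') ltm unm mk 
  (g := fun k => natfun (x k))) => //.
by move=> k /ltS; rewrite /pos /row /=; case: (odd k).
Qed.
End Family.

(** * Parameters in terms of integer logarithms *)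

(** Raise [q <= t * (q %/ t + 1) <= t * 2 ^ (q %/ t)] to the power [t]. This absorbs a power of [s]
    into the base [2 ^ (s %/ t)] of the upper bound. *)
Lemma expn_leq_exp2 q t : 0 < t -> q ^ t <= t ^ t * 2 ^ q.
Proof.
move=> t_gt0; have qt : q <= t * 2 ^ (q %/ t).
  by apply: leq_trans (ltnW (ltn_ceil q t_gt0)) _; rewrite mulnC leq_mul2l ltn_expl // orbT.
apply: (@leq_trans ((t * 2 ^ (q %/ t)) ^ t)); first by rewrite leq_exp2r.
by rewrite expnMn -expnM leq_mul2l leq_exp2l // leq_divM orbT.
Qed.

(** Bernoulli's inequality [(1 - 1/(M+1))^T >= 1 - T/(M+1) >= 1/2], cleared of denominators. *)
Lemma succ_expn_le_double M T : 2 * T <= M.+1 -> M.+1 ^ T <= 2 * M ^ T.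
Proof.
move=> TM; suff : M.+1 ^ T * (M.+1 - T) <= M.+1 * M ^ T.
  have : M.+1 <= 2 * (M.+1 - T) by lia.
  move: (M.+1 ^ T) (M ^ T) => a b; nia.
have : T <= M.+1 by lia.
elim: (T) => [|k IH] kM; first by rewrite !expn0 subn0 mul1n muln1.
have := IH (ltnW kM); rewrite !expnS.
have -> : M.+1 - k = (M.+1 - k.+1).+1 by rewrite subnSK.
have : M.+1 * (M.+1 - k.+1) <= M * (M.+1 - k.+1).+1 by nia.
move: (M.+1 ^ k) (M ^ k) (M.+1 - k.+1) => a b c; nia.
Qed.

Section Asymptotics.
Variables (t n : nat).
Let l := trunc_log 2 n.
Let s := trunc_log 2 l.
Hypotheses (t_gt1 : 1 < t) (s_large : 4 * t ^ 2 <= s).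

Let t_gt0 : 0 < t. Proof. exact: ltnW. Qed.

Let s_gt0 : 0 < s. Proof. by apply: leq_trans s_large; rewrite muln_gt0 expn_gt0 t_gt0. Qed.
Let l_gt0 : 0 < l. Proof. by move: s_gt0; rewrite /s; case: l. Qed.
Let n_gt0 : 0 < n. Proof. by move: l_gt0; rewrite /l; case: n. Qed.
Let exp_s : 2 ^ s <= l. Proof. exact: trunc_logP. Qed.
Let exp_l : 2 ^ l <= n. Proof. exact: trunc_logP. Qed.

(** The base [b = m.+1 = 2 ^ (s %/ t)] is large enough that [log n / log b = O(l / s)], and small
    enough that [b ^ t <= l]. Since [s ^ t = O(b)], the spread term times [s ^ t] is
    [O(l ^ t.-1 * b ^ t)], hence [O(l ^ t)]. *)
Lemma Ex_alternating_upper_nat :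
  s ^ t * Ex (alternating_pattern t) n <= ((6 * t) ^ t + (8 * t ^ 2) ^ t) * (n * l ^ t).
Proof.
pose q := s %/ t; pose b := 2 ^ q.
have ts : t <= s by apply: leq_trans s_large; rewrite expnS expn1; nia.
have q_gt0 : 0 < q by rewrite divn_gt0.
have b_gt1 : 1 < b by rewrite -{1}(expn0 2) ltn_exp2l.
have [m bE] : exists m, b = m.+1 by exists b.-1; rewrite prednK // ltnW.
pose k := trunc_log b n.
have n_lt : n <= m.+1 ^ k.+1 by rewrite -bE ltnW // trunc_log_ltn.
have m_gt0 : 0 < m by rewrite -ltnS -bE.
have ExU : Ex (alternating_pattern t) n <=
    n * (k.+2 ^ t + (l.+1 * (2 * m).+2) ^ t.-1).
  apply/bigmax_leqP => A /asboolP; exact: pattern_free_weight.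
have sq : s <= 2 * t * q by have := ltn_ceil s t_gt0; rewrite -/q; nia.
have kq : k * q <= l.
  by apply: trunc_log_max => //; rewrite mulnC expnM; apply: trunc_logP.
have ql : q <= l.
  apply: leq_trans (leq_trans (ltnW (ltn_expl s (isT : 1 < 2))) exp_s).
  exact: leq_div.
have part1 : s ^ t * k.+2 ^ t <= (6 * t) ^ t * l ^ t.
  rewrite -!expnMn leq_exp2r //; nia.
have part2 : s ^ t * (l.+1 * (2 * m).+2) ^ t.-1 <= (8 * t ^ 2) ^ t * l ^ t.
  have st : s ^ t <= (2 * t ^ 2) ^ t * b.
    apply: (@leq_trans ((2 * t * q) ^ t)); first by rewrite leq_exp2r.
    rewrite expnMn expnS expn1 mulnA (expnMn (2 * t)) -mulnA leq_mul2l.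
    by rewrite expn_leq_exp2 ?orbT.
  have bl : b ^ t <= l.
    by apply: leq_trans exp_s; rewrite /b -expnM leq_exp2l // leq_divM.
  have fine : (l.+1 * (2 * m).+2) ^ t.-1 <= 4 ^ t * l ^ t.-1 * b ^ t.-1.
    apply: (@leq_trans ((4 * l * b) ^ t.-1)).
      by rewrite leq_exp2r ?bE; [nia | rewrite -ltnS prednK].
    by rewrite !expnMn !leq_mul2r leq_exp2l // leq_pred !orbT.
  apply: leq_trans (leq_mul st fine) _.
  have -> : (8 * t ^ 2) ^ t = (2 * t ^ 2) ^ t * 4 ^ t by rewrite -expnMn; congr (_ ^ _); lia.
  have -> : l ^ t = l ^ t.-1 * l by rewrite -expnSr prednK.
  move: bl; have -> : b ^ t = b ^ t.-1 * b by rewrite -expnSr prednK.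
  move: ((2 * t ^ 2) ^ t) (4 ^ t) (l ^ t.-1) (b ^ t.-1) => w x y z zb.
  have -> : w * b * (x * y * z) = w * x * y * (z * b) by lia.
  by rewrite [leqRHS]mulnA leq_mul2l zb orbT.
apply: leq_trans (leq_mul (leqnn _) ExU) _.
rewrite mulnCA mulnDr [leqRHS]mulnCA leq_mul2l mulnDl leq_add ?orbT //.
Qed.

(** [L] is chosen so that words of length [T] over slightly more than [(2 * t * L) ^ t] letters
    still number at most [n]. Then [M] is the largest alphabet size with [M ^ T <= n], and this
    rounding loses at most a factor 2. *)
Lemma Ex_alternating_lower_nat :
  n * l ^ t <= 2 * (4 * t ^ 2) ^ t * (s ^ t * Ex (alternating_pattern t) n).
Proof.
pose L := l %/ (s.+1 * t ^ 2); pose T := t * L.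
have t2_gt0 : 0 < t ^ 2 by rewrite expn_gt0 t_gt0.
have L_gt0 : 0 < L.
  rewrite /L divn_gt0; last by rewrite muln_gt0.
  apply: leq_trans exp_s.
  have h1 : s.+1 <= 2 * 2 ^ (s %/ 2).
    by have := ltn_expl (s %/ 2) (isT : 1 < 2); have := ltn_ceil s (isT : 0 < 2); lia.
  have h2 : 2 * t ^ 2 <= 2 ^ (s %/ 2).
    apply: ltnW (leq_ltn_trans _ (ltn_expl (s %/ 2) (isT : 1 < 2))).
    by rewrite leq_divRL //; apply: leq_trans s_large; lia.
  have h3 : 2 ^ (s %/ 2) * 2 ^ (s %/ 2) <= 2 ^ s.
    by rewrite -expnD leq_exp2l // addnn -muln2 leq_divM.
  by apply: leq_trans h3; nia.
have Ll : L * (s.+1 * t ^ 2) <= l by rewrite leq_divM.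
have lt_l : l < 2 ^ s.+1 by apply: trunc_log_ltn.
have tL : 2 * t * L <= l.
  by apply: leq_trans Ll; rewrite mulnC leq_mul2l expnS expn1; apply/orP; right; nia.
have T_gt0 : 0 < T by rewrite muln_gt0 t_gt0.
(* As a lower bound on [M], this gives both [2 * T <= M], for the rounding, and
   [L ^ t * 2 ^ t.-1 <= M], for the construction. *)
pose M0 := (2 * t * L) ^ t.
have M0n : M0.+1 ^ T <= n.
  apply: leq_trans exp_l; apply: (@leq_trans (2 ^ (s.+1 * t * T))).
    rewrite expnM leq_exp2r // expnM /M0 ltn_exp2r //.
    exact: leq_ltn_trans tL lt_l.
  by rewrite leq_exp2l //; apply: leq_trans Ll; rewrite /T; lia.
have [M Mn maxM] : exists2 M, M ^ T <= n & forall m, m ^ T <= n -> m <= M.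
  have ex : exists m, m ^ T <= n by exists 0; rewrite exp0n.
  have bnd m : m ^ T <= n -> m <= n.
    by apply: leq_trans; case: m => // m; rewrite -{1}(expn1 m.+1) leq_pexp2l .
  by case: (ex_maxnP ex bnd) => M Mn maxM; exists M.
have M0M : M0 <= M by apply: ltnW; apply: maxM.
have nM : n < M.+1 ^ T by rewrite ltnNge; apply/negP => /maxM; rewrite ltnn.
have TM : 2 * T <= M.
  apply: leq_trans M0M; rewrite /M0 /T mulnA -{1}(expn1 (2 * t * L)).
  by rewrite leq_pexp2l // !muln_gt0 t_gt0.
have nMT : n <= 2 * M ^ T.
  by apply: leq_trans (ltnW nM) (succ_expn_le_double _); apply: ltnW.
have LM : L ^ t * 2 ^ t.-1 <= M.
  apply: leq_trans M0M; apply: (@leq_trans ((2 * L) ^ t)).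
    by rewrite expnMn mulnC leq_mul2r leq_exp2l ?leq_pred ?orbT.
  by rewrite /M0 leq_exp2r //; nia.
have := Ex_alternating_lower t_gt0 L_gt0 LM Mn; rewrite -/T => ExL.
have ll : l <= 4 * t ^ 2 * s * L.
  have := ltn_ceil l (_ : 0 < s.+1 * t ^ 2); rewrite muln_gt0 t2_gt0 => /(_ isT).
  rewrite -/L; move: (t ^ 2) t2_gt0 => u u0; nia.
have llt : l ^ t <= (4 * t ^ 2) ^ t * s ^ t * L ^ t by rewrite -!expnMn leq_exp2r.
apply: leq_trans (leq_mul nMT llt) _.
move: ((4 * t ^ 2) ^ t) (s ^ t) (L ^ t) (M ^ T) ExL => w x y z ExL.
have -> : 2 * z * (w * x * y) = 2 * w * (x * (z * y)) by lia.
by rewrite !leq_mul.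
Qed.
End Asymptotics.

(** * From integer to real logarithms *)

Unset Implicit Arguments.
Import Order.TTheory GRing.Theory Num.Theory.
Local Open Scope classical_set_scope.
Local Open Scope ring_scope.

Lemma log2_bounds (R : realType) (k : nat) (x : R) :
  2 ^+ k <= x -> x <= 2 ^+ k.+1 -> k%:R <= log2 x <= k.+1%:R.
Proof.
move=> kx xk; have x_gt0 : 0 < x by apply: lt_le_trans kx; rewrite exprn_gt0.
have ln2_gt0 : 0 < ln (2 : R) by rewrite ln_gt0 // ltr1n.
have lnX j : ln (2 ^+ j : R) = j%:R * ln 2 by rewrite lnXn // mulr_natl.
by rewrite /log2 ler_pdivlMr // ler_pdivrMr // -!lnX !ler_ln ?posrE ?exprn_gt0 // kx.
Qed.

Theorem theorem1p3 (R : realType) (t : nat) (t_ge2 : (2 <= t)%N) :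
  (fun n : nat => (Ex (alternating_pattern t) n)%:R : R)
    \is 'Theta_\oo (fun n : nat =>
      n%:R * (log2 n%:R / log2 (log2 n%:R)) ^+ t : R).
Proof.
pose C1 := ((6 * t) ^ t + (8 * t ^ 2) ^ t)%N; pose C2 := (2 * (4 * t ^ 2) ^ t)%N.
have t_gt0 : (0 < t)%N by apply: ltnW.
have C1_gt0 : (0 < C1)%N by rewrite addn_gt0 expn_gt0 muln_gt0 t_gt0.
have C2_gt0 : (0 < C2)%N by rewrite muln_gt0 expn_gt0 muln_gt0 expn_gt0 t_gt0.
(* Replacing [l / s] by the quotient of real logarithms costs a factor 2 in either direction, hence
   [2 ^ t] in both constants. *)
apply/asboolP; exists (((2 ^ t * C2)%N%:R : R)^-1, (C1 * 2 ^ t)%N%:R).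
  by rewrite /= invr_gt0 !ltr0n muln_gt0 [(0 < C1 * _)%N]muln_gt0 !expn_gt0 C1_gt0 C2_gt0.
near=> n => /=.
pose l := trunc_log 2 n; pose s := trunc_log 2 l; pose E := Ex (alternating_pattern t) n.
have n_large : (2 ^ 2 ^ (4 * t ^ 2) <= n)%N by near: n; apply: nbhs_infty_ge.
have s_large : (4 * t ^ 2 <= s)%N.
  by apply: trunc_log_max => //; apply: trunc_log_max.
have s_gt0 : (0 < s)%N by apply: leq_trans s_large; rewrite muln_gt0 expn_gt0 t_gt0.
have l_gt0 : (0 < l)%N by rewrite lt0n; apply: contraTneq s_gt0 => l0; rewrite /s l0.
have n_gt0 : (0 < n)%N by apply: leq_trans n_large; rewrite expn_gt0.
set X := log2 n%:R; set Y := log2 X.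
have /andP[lX Xl] : l%:R <= X <= l.+1%:R.
  apply: log2_bounds; rewrite -natrX ler_nat.
    exact: trunc_logP.
  by apply: ltnW; apply: trunc_log_ltn.
have /andP[sY Ys] : s%:R <= Y <= s.+1%:R.
  apply: log2_bounds; [apply: le_trans lX | apply: le_trans Xl _]; rewrite -natrX ler_nat.
    exact: trunc_logP.
  by apply: trunc_log_ltn.
have sR : 0 < s%:R :> R by rewrite ltr0n.
have lR : 0 < l%:R :> R by rewrite ltr0n.
have Y_gt0 : 0 < Y by apply: lt_le_trans sY.
have X_gt0 : 0 < X by apply: lt_le_trans lX.
have XYl : X / Y <= 2 * (l%:R / s%:R).
  rewrite mulrA ler_pM ?invr_ge0 ?(ltW X_gt0) ?(ltW Y_gt0) // ?lef_pV2 ?posrE //.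
  by apply: le_trans Xl _; rewrite -natrM ler_nat; lia.
have lXY : l%:R / s%:R <= 2 * (X / Y).
  rewrite mulrCA ler_pM ?invr_ge0 ?(ltW lR) ?(ltW sR) //.
  rewrite ler_pdivlMr // mulrC ler_pdivrMr //; apply: le_trans Ys _.
  by rewrite -natrM ler_nat; lia.
have up : (E%:R : R) <= C1%:R * (n%:R * (l%:R / s%:R) ^+ t).
  rewrite expr_div_n !mulrA ler_pdivlMr ?exprn_gt0 //.
  rewrite -!natrX -!natrM ler_nat mulnC -mulnA.
  exact: Ex_alternating_upper_nat.
have lo : n%:R * (l%:R / s%:R) ^+ t <= C2%:R * (E%:R : R).
  rewrite expr_div_n !mulrA ler_pdivrMr ?exprn_gt0 //.
  rewrite -!natrX -!natrM ler_nat -mulnA [(E * _)%N]mulnC.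
  exact: Ex_alternating_lower_nat.
have XY_ge0 : 0 <= X / Y by rewrite divr_ge0 // ltW.
have ls_ge0 : 0 <= l%:R / s%:R :> R by rewrite divr_ge0.
rewrite !ger0_norm ?mulr_ge0 ?exprn_ge0 //; split.
  rewrite ler_pdivrMl; last by rewrite ltr0n muln_gt0 expn_gt0 C2_gt0.
  rewrite natrM natrX -[leRHS]mulrA.
  apply: le_trans _ (ler_wpM2l (exprn_ge0 t (ler0n R 2)) lo).
  by rewrite [leRHS]mulrCA ler_wpM2l // -exprMn lerXn2r ?nnegrE.
apply: le_trans up _; rewrite natrM natrX -[leRHS]mulrA ler_wpM2l // [leRHS]mulrCA ler_wpM2l //.
by rewrite -exprMn lerXn2r ?nnegrE // mulr_ge0.
Unshelve. all: by end_near.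
Qed.
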